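(* There is a tree $T$ on $2\times 2$ with acyclic levels such that for each countable ordinal $\xi<\omega_1$ there is a set $S_{1+\xi}\in\mathbf{\Sigma}^0_{1+\xi}([T])$ which is not $\mathrm{pot}(\mathbf{\Pi}^0_{1+\xi})$ (as a subset of $2^\omega\times 2^\omega$).
   Context: A Borel set $A\subseteq X\times Y$ ($X,Y$ Polish) is $\mathrm{pot}(\Gamma)$ if there are Polish topologies $\sigma$ on $X$ and $\tau$ on $Y$, finer than the original ones, with $A\in\Gamma([X,\sigma]\times[Y,\tau])$. A tree $T$ on $2\times 2$ is a set of pairs $(s,t)\in\bigcup_{p\in\omega}2^p\times 2^p$ closed under restrictions; $[T]$ is the set of $(\alpha,\beta)\in 2^\omega\times 2^\omega$ with $(\alpha\upharpoonright p,\beta\upharpoonright p)\in T$ for all $p$. For $p\in\omega$ let $\mathcal T_p:=T\cap(2^p\times 2^p)$ and let $G_{\mathcal T_p}$ be the bipartite graph with vertex set $\{(s,0):s\in 2^p\}\cup\{(t,1):t\in 2^p\}$ and edges $\{(s,0),(t,1)\}$ for $(s,t)\in\mathcal T_p$. $T$ has acyclic levels if every $G_{\mathcal T_p}$ is acyclic. *)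

(* Defs.v *)
From Stdlib Require Import Reals List Arith.
Open Scope R_scope.

Definition Cantor := nat -> bool.

Definition prefix (a : Cantor) (p : nat) : list bool := map a (seq 0 p).

Definition cantor_open (U : Cantor -> Prop) : Prop :=
  forall a, U a -> exists n, forall b, (forall k, (k < n)%nat -> b k = a k) -> U b.

Definition finer {X : Type} (O O0 : (X -> Prop) -> Prop) : Prop :=
  forall U, O0 U -> O U.

Definition prod_open {X Y : Type} (OX : (X -> Prop) -> Prop) (OY : (Y -> Prop) -> Prop)
  (W : X * Y -> Prop) : Prop :=
  forall z, W z -> exists U V, OX U /\ OY V /\ U (fst z) /\ V (snd z) /\
    (forall q, U (fst q) -> V (snd q) -> W q).

Definition is_metric {X : Type} (d : X -> X -> R) : Prop :=
  (forall x y, 0 <= d x y) /\ (forall x y, d x y = 0 <-> x = y) /\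
  (forall x y, d x y = d y x) /\ (forall x y z, d x z <= d x y + d y z).

Definition metric_open {X : Type} (d : X -> X -> R) (U : X -> Prop) : Prop :=
  forall x, U x -> exists eps, 0 < eps /\ forall y, d x y < eps -> U y.

Definition metric_complete {X : Type} (d : X -> X -> R) : Prop :=
  forall u : nat -> X,
    (forall eps, 0 < eps -> exists N, forall m n, (N <= m)%nat -> (N <= n)%nat ->
        d (u m) (u n) < eps) ->
    exists x, forall eps, 0 < eps -> exists N, forall n, (N <= n)%nat -> d (u n) x < eps.

Definition metric_separable {X : Type} (d : X -> X -> R) : Prop :=
  exists D : nat -> X, forall x eps, 0 < eps -> exists n, d x (D n) < eps.

Definition polish_topology {X : Type} (O : (X -> Prop) -> Prop) : Prop :=
  exists d : X -> X -> R, is_metric d /\ metric_complete d /\ metric_separable d /\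
    forall U, O U <-> metric_open d U.

(** * Countable ordinals, represented by strict well-orders on nat.
    An ordinal xi < omega_1 is the order type of the initial segment
    {v | R v w} below some w, for some countable well-order R.  *)
Definition countable_wellorder (Rel : nat -> nat -> Prop) : Prop :=
  well_founded Rel /\ (forall x y z, Rel x y -> Rel y z -> Rel x z) /\
  (forall x y, Rel x y \/ x = y \/ Rel y x).

(** * Additive Borel classes (for metrizable spaces).
    [Sigma O Rel w A] : A is in Sigma^0_{1+xi}, where xi is the order type
    of the Rel-predecessors of w:
      Sigma^0_1 = open sets,
      Sigma^0_{1+xi} (xi >= 1) = countable unions of sets in Pi^0_{1+eta}, eta < xi. *)
Inductive Sigma {X : Type} (O : (X -> Prop) -> Prop) (Rel : nat -> nat -> Prop)
  : nat -> (X -> Prop) -> Prop :=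
| Sigma_open : forall w A, (forall v, ~ Rel v w) -> O A -> Sigma O Rel w A
| Sigma_union : forall w (A : X -> Prop) (B : nat -> X -> Prop) (v : nat -> nat),
    (forall n, Rel (v n) w) ->
    (forall n, Sigma O Rel (v n) (fun x => ~ B n x)) ->
    (forall x, A x <-> exists n, B n x) ->
    Sigma O Rel w A.

Definition Pi {X : Type} (O : (X -> Prop) -> Prop) (Rel : nat -> nat -> Prop)
  (w : nat) (A : X -> Prop) : Prop :=
  Sigma O Rel w (fun x => ~ A x).

Definition pot_Pi (Rel : nat -> nat -> Prop) (w : nat) (A : Cantor * Cantor -> Prop) : Prop :=
  exists (Osig Otau : (Cantor -> Prop) -> Prop),
    polish_topology Osig /\ finer Osig cantor_open /\
    polish_topology Otau /\ finer Otau cantor_open /\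
    Pi (prod_open Osig Otau) Rel w A.

Definition is_tree (T : list bool -> list bool -> Prop) : Prop :=
  (forall s t, T s t -> length s = length t) /\
  (forall s t p, T s t -> (p <= length s)%nat -> T (firstn p s) (firstn p t)).

Definition body (T : list bool -> list bool -> Prop) (z : Cantor * Cantor) : Prop :=
  forall p, T (prefix (fst z) p) (prefix (snd z) p).

(* the graph G_{T_p}: vertices (s,false) = (s,0), (t,true) = (t,1), s,t in 2^p *)
Definition level_adj (T : list bool -> list bool -> Prop) (p : nat)
  (x y : list bool * bool) : Prop :=
  length (fst x) = p /\ length (fst y) = p /\
  ((snd x = false /\ snd y = true /\ T (fst x) (fst y)) \/
   (snd x = true /\ snd y = false /\ T (fst y) (fst x))).

Definition is_cycle {V : Type} (adj : V -> V -> Prop) (l : list V) : Prop :=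
  (3 <= length l)%nat /\ NoDup l /\
  exists d : V,
    (forall i, (S i < length l)%nat -> adj (nth i l d) (nth (S i) l d)) /\
    adj (last l d) (hd d l).

Definition acyclic {V : Type} (adj : V -> V -> Prop) : Prop :=
  forall l, ~ is_cycle adj l.

Definition acyclic_levels (T : list bool -> list bool -> Prop) : Prop :=
  forall p, acyclic (level_adj T p).

Definition body_space (T : list bool -> list bool -> Prop) : Type :=
  { z : Cantor * Cantor | body T z }.

Definition body_open (T : list bool -> list bool -> Prop) (W : body_space T -> Prop) : Prop :=
  exists U, prod_open cantor_open cantor_open U /\ forall z, W z <-> U (proj1_sig z).

(* Main.v *)
(* Let T consist of the pairs (s, t) that agree at every position l, except that
   s(l) = 0, t(l) = 1 is also allowed when (s|l, t|l) is the l-th term of a sequence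
   which meets the extensions of every (s, t) in T, with any prescribed label (n, b) in
   omega x 2 attached to l.  Each level is two copies of the previous one joined by at
   most one edge, hence acyclic.

   The labels of the positions where alpha and beta differ code a partial point of
   2^omega (label (n, b) says that bit n is b), and S is the set of (alpha, beta) in [T]
   whose coded point lies in the diagonal of a universal Sigma^0_{1+xi} set, written
   positively in these labels.  If S were pot(Pi^0_{1+xi}), a fusion would produce a map
   f : 2^omega -> [T], continuous into the product of the two finer Polish topologies,
   such that f(x) codes x; pulling S back along f would make that diagonal Pi^0_{1+xi}.
   The fusion keeps, besides the finite strings, sets of small diameter for the finer
   metrics that are nonmeager everywhere in the corresponding cylinders.  So nothing needs
   to be known about the Borel complexity of the finer open sets. *)

Require Import Defs.
From Stdlib Require Import Reals List Arith Lia Lra Cantor ClassicalEpsilon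
  IndefiniteDescription FunctionalExtensionality PropExtensionality.
Import ListNotations.
Local Open Scope nat_scope.

Lemma pred_ext {X : Type} (A B : X -> Prop) : (forall x, A x <-> B x) -> A = B.
Proof.
  intros H. apply functional_extensionality. intros x.
  apply propositional_extensionality. apply H.
Qed.

(** * Finite binary strings *)

(** The leading digit 1 of a positive number acts as an end marker, so every binary string occurs,
    also those ending in zeros. *)
Fixpoint bits (p : positive) : list bool :=
  match p with
  | xH => []
  | xO q => false :: bits q
  | xI q => true :: bits q
  end.

Definition string_of (n : nat) : list bool := bits (Pos.of_nat n).

Lemma string_of_surj (s : list bool) : exists n, string_of n = s.
Proof.
  assert (H : exists p, bits p = s).
  { induction s as [|[] s [p Hp]].
    - now exists xH.
    - exists (xI p). simpl. now rewrite Hp.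
    - exists (xO p). simpl. now rewrite Hp. }
  destruct H as [p Hp]. exists (Pos.to_nat p).
  unfold string_of. now rewrite Pos2Nat.id.
Qed.

Definition cyl (s : list bool) (a : Cantor) : Prop := prefix a (length s) = s.

Lemma prefix_length (a : Cantor) (p : nat) : length (prefix a p) = p.
Proof. unfold prefix. now rewrite length_map, length_seq. Qed.

Lemma nth_prefix (a : Cantor) (p i : nat) (d : bool) : i < p -> nth i (prefix a p) d = a i.
Proof.
  intros H. rewrite nth_indep with (d' := a 0) by now rewrite prefix_length.
  unfold prefix. rewrite map_nth. now rewrite seq_nth.
Qed.

Lemma firstn_prefix (a : Cantor) (p q : nat) : p <= q -> firstn p (prefix a q) = prefix a p.
Proof.
  intros H. replace q with (p + (q - p)) by lia. unfold prefix.
  rewrite seq_app, map_app, firstn_app, length_map, length_seq, Nat.sub_diag.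
  rewrite firstn_all2 by (rewrite length_map, length_seq; lia).
  simpl. now rewrite app_nil_r.
Qed.

Lemma cyl_nth (s : list bool) (a : Cantor) (d : bool) :
  cyl s a <-> forall i, i < length s -> a i = nth i s d.
Proof.
  unfold cyl. split.
  - intros H i Hi. rewrite <- H. symmetry. now apply nth_prefix.
  - intros H. apply nth_ext with (d := d) (d' := d).
    + apply prefix_length.
    + intros i. rewrite prefix_length. intros Hi.
      rewrite nth_prefix by easy. now apply H.
Qed.

Lemma cyl_prefix (a : Cantor) (p : nat) : cyl (prefix a p) a.
Proof. unfold cyl. now rewrite prefix_length. Qed.

Lemma cyl_app (s w : list bool) (a : Cantor) : cyl (s ++ w) a -> cyl s a.
Proof.
  unfold cyl. intros H.
  rewrite <- (firstn_prefix a (length s) (length (s ++ w)))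
    by (rewrite length_app; lia).
  rewrite H, firstn_app, Nat.sub_diag, firstn_all. simpl. now rewrite app_nil_r.
Qed.

Lemma prefix_ext (s : list bool) (a : Cantor) (p : nat) :
  cyl s a -> length s <= p -> exists w, prefix a p = s ++ w.
Proof.
  intros H Hp. exists (skipn (length s) (prefix a p)).
  rewrite <- (firstn_skipn (length s) (prefix a p)) at 1.
  rewrite firstn_prefix by easy. now rewrite H.
Qed.

Lemma cyl_open (s : list bool) : cantor_open (cyl s).
Proof.
  intros a Ha. exists (length s). intros b Hb.
  apply (cyl_nth s b false). intros i Hi. rewrite Hb by easy.
  now apply (cyl_nth s a false).
Qed.

Lemma cyl_limit (u w : nat -> list bool) :
  (forall n, u (S n) = u n ++ w n) -> (forall n, w n <> []) ->
  exists a, forall n, cyl (u n) a.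
Proof.
  intros Hu Hw.
  assert (Hlen : forall n, n <= length (u n)).
  { induction n as [|n IH]; [lia|]. rewrite Hu, length_app.
    specialize (Hw n). destruct (w n); [easy|]. simpl. lia. }
  assert (Hext : forall k n, exists v, u (n + k) = u n ++ v).
  { induction k as [|k IH]; intros n.
    - exists []. now rewrite Nat.add_0_r, app_nil_r.
    - destruct (IH n) as [v Hv]. exists (v ++ w (n + k)).
      now rewrite Nat.add_succ_r, Hu, Hv, app_assoc. }
  (* Each step adds at least one bit, so [u (S i)] is longer than [i] and the default [false] is
     never read. *)
  exists (fun i => nth i (u (S i)) false). intros n.
  apply (cyl_nth _ _ false). intros i Hi.
  specialize (Hlen (S i)).
  destruct (Nat.le_ge_cases n (S i)) as [H|H].
  - destruct (Hext (S i - n) n) as [v Hv]. replace (n + (S i - n)) with (S i) in Hv by lia.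
    rewrite Hv. now rewrite app_nth1.
  - destruct (Hext (n - S i) (S i)) as [v Hv]. replace (S i + (n - S i)) with n in Hv by lia.
    rewrite Hv. rewrite app_nth1; [easy|lia].
Qed.

(** * Baire category in the Cantor space *)

Definition nowhere_dense (F : Cantor -> Prop) : Prop :=
  forall u, exists w, forall a, cyl (u ++ w) a -> ~ F a.

Definition meager (A : Cantor -> Prop) : Prop :=
  exists F : nat -> Cantor -> Prop,
    (forall n, nowhere_dense (F n)) /\ forall a, A a -> exists n, F n a.

Lemma meager_subset (A B : Cantor -> Prop) :
  (forall a, A a -> B a) -> meager B -> meager A.
Proof. intros H [F [HF HB]]. exists F. split; auto. Qed.

Lemma nowhere_dense_meager (F : Cantor -> Prop) : nowhere_dense F -> meager F.
Proof. intros H. exists (fun _ => F). split; [easy|]. intros a Ha. now exists 0. Qed.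

Lemma meager_empty : meager (fun _ => False).
Proof. apply nowhere_dense_meager. intros u. exists []. auto. Qed.

Lemma meager_bigcup (A : nat -> Cantor -> Prop) :
  (forall n, meager (A n)) -> meager (fun a => exists n, A n a).
Proof.
  intros H. apply functional_choice in H. destruct H as [F HF].
  exists (fun m => F (fst (Cantor.of_nat m)) (snd (Cantor.of_nat m))). split.
  - intros m. apply HF.
  - intros a [n Ha]. destruct (proj2 (HF n) a Ha) as [k Hk].
    exists (Cantor.to_nat (n, k)). now rewrite Cantor.cancel_of_to.
Qed.

Lemma meager_union (A B : Cantor -> Prop) :
  meager A -> meager B -> meager (fun a => A a \/ B a).
Proof.
  intros HA HB.
  apply meager_subset with (fun a => exists n : nat, (match n with 0 => A | _ => B end) a).
  - intros a [H|H]; [now exists 0|now exists 1].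
  - apply meager_bigcup. now intros [|n].
Qed.

(** The Baire category theorem: a chain of cylinders avoids one [F n] at each step. The extra bit
    [false] makes the chain grow even when [g] returns the empty string. *)
Lemma cyl_nonmeager (u : list bool) : ~ meager (cyl u).
Proof.
  intros [F [HF Hcov]].
  assert (H : forall p : nat * list bool, exists w, forall a, cyl (snd p ++ w) a -> ~ F (fst p) a).
  { intros [n v]. apply HF. }
  apply functional_choice in H. destruct H as [g Hg].
  set (v := fix v n := match n with
    | 0 => u
    | S n => v n ++ g (n, v n) ++ [false] end).
  destruct (cyl_limit v (fun n => g (n, v n) ++ [false])) as [a Ha].
  - reflexivity.
  - intros n H. now apply app_eq_nil in H.
  - destruct (Hcov a (Ha 0)) as [n Hn].
    apply (Hg (n, v n) a); [|easy]. simpl.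
    apply cyl_app with [false]. rewrite <- app_assoc. apply (Ha (S n)).
Qed.

(** As [A] is arbitrary, without the Baire property, it cannot be made comeager in a cylinder. Being
    nonmeager in all subcylinders is the notion that survives countable splittings. *)
Definition everywhere_nonmeager (u : list bool) (A : Cantor -> Prop) : Prop :=
  forall w, ~ meager (fun a => A a /\ cyl (u ++ w) a).

Lemma everywhere_nonmeager_app (u w : list bool) (A : Cantor -> Prop) :
  everywhere_nonmeager u A -> everywhere_nonmeager (u ++ w) A.
Proof. intros H v. rewrite <- app_assoc. apply H. Qed.

Lemma everywhere_nonmeager_full (u : list bool) : everywhere_nonmeager u (fun _ => True).
Proof.
  intros w H. apply (cyl_nonmeager (u ++ w)). revert H. now apply meager_subset.
Qed.

Lemma everywhere_nonmeager_inhabited (u : list bool) (A : Cantor -> Prop) :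
  everywhere_nonmeager u A -> exists a, A a /\ cyl u a.
Proof.
  intros H. apply NNPP. intros Hn. apply (H []).
  apply meager_subset with (fun _ => False); [|apply meager_empty].
  intros a Ha. apply Hn. exists a. now rewrite app_nil_r in Ha.
Qed.

(** Otherwise every subcylinder of [cyl u] contains one in which [A] is meager. These countably many
    cylinders cover [cyl u] up to a nowhere dense remainder [R], so [A] is meager in [cyl u]. *)
Lemma nonmeager_localize (u : list bool) (A : Cantor -> Prop) :
  ~ meager (fun a => A a /\ cyl u a) -> exists w, everywhere_nonmeager (u ++ w) A.
Proof.
  intros HA. apply NNPP. intros Hn. apply HA.
  assert (Hm : forall w, exists w', meager (fun a => A a /\ cyl (u ++ w ++ w') a)).
  { intros w. apply NNPP. intros H. apply Hn. exists w. intros w' Hw'.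
    apply H. exists w'. now rewrite app_assoc. }
  pose (R := fun a => cyl u a /\
    forall w, meager (fun a => A a /\ cyl (u ++ w) a) -> ~ cyl (u ++ w) a).
  apply meager_subset with (fun a => R a \/ exists n,
    (A a /\ cyl (u ++ string_of n) a) /\
    meager (fun a => A a /\ cyl (u ++ string_of n) a)).
  - intros a [Aa ua]. destruct (classic (R a)) as [HR|HR]; [now left|right].
    apply NNPP. intros H. apply HR. split; [easy|]. intros w Hw Hc. apply H.
    destruct (string_of_surj w) as [n <-]. now exists n.
  - apply meager_union.
    + apply nowhere_dense_meager. intros v.
      (* Either [cyl v] misses [cyl u], or [u] and [v] have a common prolongation, below which lies
         a cylinder excluded from [R]. *)
      destruct (classic (exists x, cyl v x /\ cyl u x)) as [[x [Hv Hu]]|Hd].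
      * destruct (prefix_ext v x (max (length u) (length v)) Hv) as [r Hr]; [lia|].
        destruct (prefix_ext u x (max (length u) (length v)) Hu) as [r' Hr']; [lia|].
        destruct (Hm r') as [w' Hw'].
        exists (r ++ w'). rewrite app_assoc, <- Hr, Hr', <- app_assoc.
        intros a Ha [_ HR]. now apply (HR (r' ++ w')).
      * exists []. rewrite app_nil_r. intros a Ha [Hu _]. apply Hd. now exists a.
    + apply meager_bigcup. intros n.
      destruct (classic (meager (fun a => A a /\ cyl (u ++ string_of n) a))) as [H|H].
      * revert H. now apply meager_subset.
      * apply meager_subset with (fun _ => False); [|apply meager_empty]. easy.
Qed.

Lemma everywhere_nonmeager_split (u : list bool) (A : Cantor -> Prop)
  (B : nat -> Cantor -> Prop) :
  everywhere_nonmeager u A -> (forall a, exists n, B n a) ->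
  exists w n, everywhere_nonmeager (u ++ w) (fun a => A a /\ B n a).
Proof.
  intros HA HB. apply NNPP. intros Hn. apply (HA []). rewrite app_nil_r.
  apply meager_subset with (fun a => exists n, (A a /\ B n a) /\ cyl u a).
  - intros a [Aa ua]. destruct (HB a) as [n Hn']. now exists n.
  - apply meager_bigcup. intros n. apply NNPP. intros H.
    apply nonmeager_localize in H. destruct H as [w Hw]. apply Hn. now exists w, n.
Qed.

(** * The tree *)

(** [l] codes four data and a dummy component; letting the dummy grow, every datum recurs at
    arbitrarily large [l]. *)
Definition frame_data (l : nat) : (list bool * list bool) * (nat * bool) :=
  let (k, _) := Cantor.of_nat l in
  let (k1, k2) := Cantor.of_nat k in
  let (i, j) := Cantor.of_nat k1 in
  let (n, e) := Cantor.of_nat k2 in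
  ((string_of i, string_of j), (n, Nat.eqb e 0)).

Lemma frame_data_cofinal (s t : list bool) (n : nat) (e : bool) (m : nat) :
  exists l, m <= l /\ frame_data l = ((s, t), (n, e)).
Proof.
  destruct (string_of_surj s) as [i Hi]. destruct (string_of_surj t) as [j Hj].
  exists (Cantor.to_nat (Cantor.to_nat (Cantor.to_nat (i, j),
    Cantor.to_nat (n, if e then 0 else 1)), m)).
  split.
  - eapply Nat.le_trans; [apply Nat.le_add_r|apply Cantor.to_nat_non_decreasing].
  - unfold frame_data. rewrite !Cantor.cancel_of_to, Hi, Hj. now destruct e.
Qed.

(* The pair [(frame_left l, frame_right l)] has no effect on the tree below when it is not
   already a pair of length [l] in it. *)
Definition frame_left (l : nat) : list bool :=
  let s := fst (fst (frame_data l)) in s ++ repeat false (l - length s).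

Definition frame_right (l : nat) : list bool :=
  let t := snd (fst (frame_data l)) in t ++ repeat false (l - length t).

Definition frame_code (l : nat) : nat * bool := snd (frame_data l).

Inductive frame_tree : list bool -> list bool -> Prop :=
| frame_tree_nil : frame_tree [] []
| frame_tree_same : forall s t e, frame_tree s t -> frame_tree (s ++ [e]) (t ++ [e])
| frame_tree_split : forall s t, frame_tree s t ->
    s = frame_left (length s) -> t = frame_right (length s) ->
    frame_tree (s ++ [false]) (t ++ [true]).

Lemma frame_tree_app (s t w : list bool) : frame_tree s t -> frame_tree (s ++ w) (t ++ w).
Proof.
  revert s t. induction w as [|e w IH]; intros s t H.
  - now rewrite !app_nil_r.
  - change (e :: w) with ([e] ++ w). rewrite !app_assoc. apply IH. now constructor.
Qed.

Lemma frame_tree_length (s t : list bool) : frame_tree s t -> length s = length t.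
Proof. induction 1; rewrite ?length_app; simpl; lia. Qed.

Lemma frame_tree_is_tree : is_tree frame_tree.
Proof.
  split; [exact frame_tree_length|].
  assert (cut : forall s t e e' p,
    length s = length t -> frame_tree (s ++ [e]) (t ++ [e']) ->
    (p <= length s -> frame_tree (firstn p s) (firstn p t)) ->
    p <= length (s ++ [e]) -> frame_tree (firstn p (s ++ [e])) (firstn p (t ++ [e']))).
  { intros s t e e' p Hl Hst IH Hp. rewrite length_app in Hp. simpl in Hp.
    destruct (Nat.eq_dec p (length s + 1)) as [->|Hne].
    - rewrite !firstn_all2 by (rewrite length_app; simpl; lia). easy.
    - rewrite !firstn_app.
      replace (p - length s) with 0 by lia. replace (p - length t) with 0 by lia.
      simpl. rewrite !app_nil_r. apply IH. lia. }
  intros s t p H. revert p. induction H as [|s t e H IH|s t H IH Hs Ht]; intros p.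
  - intros _. rewrite firstn_nil. constructor.
  - apply cut; auto using frame_tree_length, frame_tree_same.
  - apply cut; auto using frame_tree_length, frame_tree_split.
Qed.

Lemma frame_tree_snoc (s t : list bool) (e e' : bool) :
  frame_tree (s ++ [e]) (t ++ [e']) ->
  frame_tree s t /\
  (e = e' \/ (e = false /\ e' = true /\
    s = frame_left (length s) /\ t = frame_right (length s))).
Proof.
  intros H. inversion H as [Hs Ht|s0 t0 e0 H0 Hs Ht|s0 t0 H0 H1 H2 Hs Ht].
  - symmetry in Hs. now apply app_eq_nil in Hs.
  - apply app_inj_tail in Hs. apply app_inj_tail in Ht.
    destruct Hs as [<- <-], Ht as [<- <-]. auto.
  - apply app_inj_tail in Hs. apply app_inj_tail in Ht.
    destruct Hs as [<- <-], Ht as [<- <-]. auto 6.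
Qed.

(** * Acyclicity *)

(** A cycle as a periodic sequence: the closing edge needs no separate treatment, and distinctness
    of the vertices becomes injectivity modulo [n]. *)
Definition cyclic_walk {V : Type} (adj : V -> V -> Prop) (n : nat) (c : nat -> V) : Prop :=
  (forall i, adj (c i) (c (S i))) /\ (forall i, c (i + n) = c i) /\
  (forall i j, c i = c j -> i mod n = j mod n).

Lemma cycle_walk {V : Type} (adj : V -> V -> Prop) (l : list V) :
  is_cycle adj l -> exists c, cyclic_walk adj (length l) c.
Proof.
  intros [Hl [Hnd [d [Hadj Hlast]]]]. set (n := length l) in *.
  exists (fun i => nth (i mod n) l d). repeat split.
  - intros i. assert (Hi := Nat.mod_upper_bound i n ltac:(lia)).
    destruct (Nat.eq_dec (S (i mod n)) n) as [H|H].
    + replace (S i mod n) with 0.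
      * replace (i mod n) with (n - 1) by lia.
        replace (nth (n - 1) l d) with (last l d).
        -- replace (nth 0 l d) with (hd d l) by now destruct l. easy.
        -- destruct (@exists_last _ l) as [l' [x Hx]]; [now destruct l|].
           subst n. rewrite Hx, last_last, length_app. simpl.
           rewrite app_nth2 by lia. now replace (length l' + 1 - 1 - length l') with 0 by lia.
      * apply Nat.mod_unique with (S (i / n)); [lia|].
        assert (E := Nat.div_mod_eq i n). nia.
    + replace (S i mod n) with (S (i mod n)).
      * apply Hadj. lia.
      * apply Nat.mod_unique with (i / n); [lia|].
        assert (E := Nat.div_mod_eq i n). nia.
  - intros i. f_equal. replace (i + n) with (i + 1 * n) by lia. apply Nat.Div0.mod_add.
  - intros i j H. apply (proj1 (NoDup_nth l d) Hnd); try easy;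
      apply Nat.mod_upper_bound; lia.
Qed.

(** Excludes running back and forth along one edge; this is where length at least 3 enters. *)
Lemma mod_add2 (n i : nat) : 3 <= n -> (i + 2) mod n <> i mod n.
Proof.
  intros Hn H.
  assert (E := Nat.div_mod_eq i n). assert (E' := Nat.div_mod_eq (i + 2) n).
  rewrite H in E'. destruct (Nat.le_gt_cases ((i + 2) / n) (i / n)); nia.
Qed.

(** Otherwise the value stays [b] forever once it is taken, while periodicity brings [negb b] back
    later. *)
Lemma walk_switch (n : nat) (chi : nat -> bool) (b : bool) :
  0 < n -> (forall i, chi (i + n) = chi i) ->
  (exists i j, chi i <> chi j) -> exists i, chi i = b /\ chi (S i) = negb b.
Proof.
  intros Hn Hper [i [j Hij]].
  assert (Hk : forall k i, chi (i + k * n) = chi i).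
  { induction k as [|k IH]; intros i'; [now rewrite Nat.add_0_r|].
    simpl. replace (i' + (n + k * n)) with ((i' + k * n) + n) by lia. now rewrite Hper. }
  assert (H : exists i j, chi i = b /\ chi j = negb b).
  { destruct (chi i) eqn:Ei, (chi j) eqn:Ej, b; try easy; eauto. }
  destruct H as [i0 [j0 [H0 H1]]].
  apply NNPP. intros Hno.
  assert (Hconst : forall k, chi (i0 + k) = b).
  { induction k as [|k IH]; [now rewrite Nat.add_0_r|].
    rewrite Nat.add_succ_r.
    destruct (Bool.bool_dec (chi (S (i0 + k))) b) as [E|E]; [easy|].
    exfalso. apply Hno. exists (i0 + k). split; [easy|].
    now destruct (chi (S (i0 + k))), b. }
  (* The index [j0 + i0 * n] is a translate of [j0] by periods and is at least [i0], since
     [0 < n]. *)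
  specialize (Hconst (j0 + i0 * n - i0)).
  replace (i0 + (j0 + i0 * n - i0)) with (j0 + i0 * n) in Hconst by nia.
  rewrite Hk, H1 in Hconst. now destruct b.
Qed.

(** Only [frame_tree_split] sets the last bits apart, and at length [p] it applies to a single pair.
    The two implications are the two directions of travel along that edge. *)
Lemma level_adj_S (p : nat) (s t : list bool) (e e' x y : bool) :
  level_adj frame_tree (S p) (s ++ [e], x) (t ++ [e'], y) ->
  level_adj frame_tree p (s, x) (t, y) /\
  (e = false -> e' = true ->
    (s ++ [e], x) = (frame_left p ++ [false], false) /\
    (t ++ [e'], y) = (frame_right p ++ [true], true)) /\
  (e = true -> e' = false ->
    (s ++ [e], x) = (frame_right p ++ [true], true) /\
    (t ++ [e'], y) = (frame_left p ++ [false], false)).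
Proof.
  intros [Hs [Ht H]]. simpl in *. rewrite length_app in Hs, Ht. simpl in Hs, Ht.
  assert (Es : length s = p) by lia. assert (Et : length t = p) by lia.
  unfold level_adj; simpl.
  destruct H as [[-> [-> H]]|[-> [-> H]]]; apply frame_tree_snoc in H;
    destruct H as [H [->|[-> [-> [E1 E2]]]]].
  all: repeat split; auto; try (intros; subst; congruence).
  all: intros; rewrite ?Es, ?Et in *; congruence.
Qed.

(* Level [p + 1] consists of two copies of level [p], told apart by the last bit,
   joined by at most one edge; a cycle visiting both copies would traverse that
   edge in both directions. *)
Lemma frame_tree_no_walk (p n : nat) (c : nat -> list bool * bool) :
  3 <= n -> ~ cyclic_walk (level_adj frame_tree p) n c.
Proof.
  intros Hn. revert c. induction p as [|p IH]; intros c [Hadj [Hper Hinj]].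
  (* Level 0 has one vertex on each side, so two steps lead back to the start. *)
  - apply (mod_add2 n 0 Hn). symmetry. apply Hinj.
    destruct (Hadj 0) as [L0 [L1 H0]], (Hadj 1) as [_ [L2 H1]]. simpl in *.
    destruct (c 0) as [s x], (c 1) as [t y], (c 2) as [r z]. simpl in *.
    apply length_zero_iff_nil in L0, L2. subst.
    f_equal. destruct H0 as [[? [? _]]|[? [? _]]], H1 as [[? [? _]]|[? [? _]]]; congruence.
  - pose (c' := fun i => (removelast (fst (c i)), snd (c i))).
    pose (chi := fun i => last (fst (c i)) false).
    assert (Hc : forall i, c i = (fst (c' i) ++ [chi i], snd (c' i))).
    { intros i. destruct (Hadj i) as [L _]. unfold c', chi. simpl.
      rewrite <- app_removelast_last; [now destruct (c i)|].
      intros H. now rewrite H in L. }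
    assert (Hstep : forall i, level_adj frame_tree p (c' i) (c' (S i)) /\
      (chi i = false -> chi (S i) = true ->
        c i = (frame_left p ++ [false], false) /\
        c (S i) = (frame_right p ++ [true], true)) /\
      (chi i = true -> chi (S i) = false ->
        c i = (frame_right p ++ [true], true) /\
        c (S i) = (frame_left p ++ [false], false))).
    { intros i. specialize (Hadj i). rewrite (Hc i), (Hc (S i)) in Hadj |- *.
      apply level_adj_S in Hadj. exact Hadj. }
    destruct (classic (exists i j, chi i <> chi j)) as [Hne|Heq].
    + assert (Hchi : forall i, chi (i + n) = chi i) by (intros; unfold chi; now rewrite Hper).
      destruct (walk_switch n chi false) as [i [Hi Hi']]; [lia|easy|easy|].
      destruct (walk_switch n chi true) as [j [Hj Hj']]; [lia|easy|easy|].
      destruct (proj1 (proj2 (Hstep i)) Hi Hi') as [Ei Ei'].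
      destruct (proj2 (proj2 (Hstep j)) Hj Hj') as [Ej Ej'].
      (* Now [c (S j) = c i] and [c j = c (S i)], so [i + 2] and [i] agree modulo [n]. *)
      rewrite <- Ei in Ej'. rewrite <- Ei' in Ej.
      apply Hinj in Ej, Ej'.
      apply (mod_add2 n i Hn).
      replace (i + 2) with (S i + 1) by lia.
      rewrite Nat.Div0.add_mod, <- Ej, <- Nat.Div0.add_mod, <- Ej'. f_equal. lia.
    (* With a constant last bit the walk stays in one copy, and deleting the bit keeps its vertices
       distinct. *)
    + apply (IH c'). split; [|split].
      * intros i. apply Hstep.
      * intros i. unfold c'. now rewrite Hper.
      * intros i j H. apply Hinj. rewrite (Hc i), (Hc j), H.
        destruct (Bool.bool_dec (chi i) (chi j)) as [->|E]; [easy|].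
        exfalso. apply Heq. now exists i, j.
Qed.

Lemma frame_tree_acyclic : acyclic_levels frame_tree.
Proof.
  intros p l Hl. destruct (cycle_walk _ _ Hl) as [c Hc].
  apply (frame_tree_no_walk p (length l) c); [apply Hl|easy].
Qed.

(** * Universal sets *)

Lemma Sigma_preimage {X Y : Type} (OX : (X -> Prop) -> Prop) (OY : (Y -> Prop) -> Prop)
  (Rel : nat -> nat -> Prop) (f : X -> Y) (w : nat) (A : Y -> Prop) :
  (forall U, OY U -> OX (fun x => U (f x))) ->
  Sigma OY Rel w A -> Sigma OX Rel w (fun x => A (f x)).
Proof.
  intros Hf. induction 1 as [w A Hw HA|w A B v Hv HB IH HA].
  - apply Sigma_open; auto.
  - apply Sigma_union with (B := fun n x => B n (f x)) (v := v); auto.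
Qed.

(** Provides the padding for countable unions in which some indices are to contribute nothing. *)
Lemma Sigma_trivial {X : Type} (O : (X -> Prop) -> Prop) (Rel : nat -> nat -> Prop) :
  well_founded Rel -> O (fun _ => False) -> O (fun _ => True) ->
  forall w, Sigma O Rel w (fun _ => False) /\ Sigma O Rel w (fun _ => True).
Proof.
  intros Hwf HF HT w. induction w as [w IH] using (well_founded_induction Hwf).
  destruct (classic (exists v, Rel v w)) as [[v Hv]|Hmin].
  - destruct (IH v Hv) as [IF IT]. split.
    + apply Sigma_union with (B := fun _ _ => False) (v := fun _ => v); auto.
      * intros _. replace (fun _ : X => ~ False) with (fun _ : X => True); [easy|].
        apply pred_ext. tauto.
      * intros _. split; [easy|]. now intros [_ ?].
    + apply Sigma_union with (B := fun _ _ => True) (v := fun _ => v); auto.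
      * intros _. replace (fun _ : X => ~ True) with (fun _ : X => False); [easy|].
        apply pred_ext. tauto.
      * intros _. split; [|easy]. intros _. now exists 0.
  - split; apply Sigma_open; eauto.
Qed.

(** Position, within a code, of bit [k] of the part describing the [n]-th piece when that piece has
    index [u]. *)
Definition subindex (n u k : nat) : nat := Cantor.to_nat (Cantor.to_nat (n, u), k).

(* [Q n b] reads "bit [n] of the point is [b]", but nothing forces exactly one of
   [Q n true], [Q n false] to hold.  The bits at the positions [sg k] code a
   [Sigma_w] set, in which the point itself is then looked up. *)
Fixpoint universal (Rel : nat -> nat -> Prop) (w : nat) (a : Acc Rel w)
  (sg : nat -> nat) (Q : nat -> bool -> Prop) {struct a} : Prop :=
  ((forall v, ~ Rel v w) /\
   exists k, Q (sg k) true /\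
     forall j, j < length (string_of k) -> Q j (nth j (string_of k) false)) \/
  (exists n u, exists r : Rel u w,
     ~ universal Rel u (Acc_inv a r) (fun k => sg (subindex n u k)) Q).

Lemma universal_iff (Rel : nat -> nat -> Prop) (w : nat) (a : Acc Rel w)
  (sg : nat -> nat) (Q : nat -> bool -> Prop) :
  universal Rel w a sg Q <->
  ((forall v, ~ Rel v w) /\
   exists k, Q (sg k) true /\
     forall j, j < length (string_of k) -> Q j (nth j (string_of k) false)) \/
  (exists n u, exists r : Rel u w,
     ~ universal Rel u (Acc_inv a r) (fun k => sg (subindex n u k)) Q).
Proof. destruct a. reflexivity. Qed.

(** The first clause is closure under unions in local form; it also gives the empty set. *)
Definition topology {X : Type} (O : (X -> Prop) -> Prop) : Prop :=
  (forall A : X -> Prop, (forall x, A x -> exists U, O U /\ U x /\ forall y, U y -> A y) -> O A) /\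
  O (fun _ => True) /\
  (forall U V, O U -> O V -> O (fun x => U x /\ V x)).

Lemma topology_forall_lt {X : Type} (O : (X -> Prop) -> Prop) (U : nat -> X -> Prop) (m : nat) :
  topology O -> (forall j, O (U j)) -> O (fun x => forall j, j < m -> U j x).
Proof.
  intros [_ [HT HI]] HU. induction m as [|m IH].
  - replace (fun x => forall j, j < 0 -> U j x) with (fun _ : X => True); [easy|].
    apply pred_ext. intros x. split; [lia|easy].
  - replace (fun x => forall j, j < S m -> U j x)
      with (fun x => (forall j, j < m -> U j x) /\ U m x); [now apply HI|].
    apply pred_ext. intros x. split.
    + intros [H1 H2] j Hj. destruct (Nat.eq_dec j m) as [->|]; [easy|]. apply H1. lia.
    + intros H. split; auto.
Qed.

(** The bits enter the base level only positively, so it is open. Above it, the disjunction over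
    [(n, u)] is the required countable union. *)
Lemma universal_Sigma {X : Type} (O : (X -> Prop) -> Prop) (Rel : nat -> nat -> Prop)
  (P : X -> nat -> bool -> Prop) :
  topology O -> well_founded Rel -> (forall n b, O (fun x => P x n b)) ->
  forall w a sg, Sigma O Rel w (fun x => universal Rel w a sg (P x)).
Proof.
  intros HO Hwf HP w. induction w as [w IH] using (well_founded_induction Hwf).
  intros a sg. destruct HO as [Hloc HO'].
  assert (HF : O (fun _ => False)) by now apply Hloc.
  assert (HTr := Sigma_trivial O Rel Hwf HF (proj1 HO')).
  destruct (classic (exists v, Rel v w)) as [[v0 Hv0]|Hmin].
  (* A pair with [u] not below [w] contributes the empty set; the predecessor [v0] then serves as
     its index. *)
  - pose (dec := fun m => let (n, u) := Cantor.of_nat m in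
      if excluded_middle_informative (Rel u w) then u else v0).
    apply Sigma_union with (v := dec)
      (B := fun m x => exists r : Rel (snd (Cantor.of_nat m)) w,
        ~ universal Rel (snd (Cantor.of_nat m)) (Acc_inv a r)
            (fun k => sg (subindex (fst (Cantor.of_nat m)) (snd (Cantor.of_nat m)) k)) (P x)).
    + intros m. unfold dec. destruct (Cantor.of_nat m) as [n u].
      now destruct (excluded_middle_informative (Rel u w)).
    + intros m. unfold dec. destruct (Cantor.of_nat m) as [n u]. simpl.
      destruct (excluded_middle_informative (Rel u w)) as [r|Hr].
      * assert (E := IH u r (Acc_inv a r) (fun k => sg (subindex n u k))).
        eapply eq_ind; [exact E|]. apply pred_ext. intros x. split.
        -- intros H [r' Hr']. apply Hr'. now rewrite (proof_irrelevance _ r' r).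
        -- intros H. apply NNPP. intros H'. apply H. now exists r.
      * eapply eq_ind; [apply (HTr v0)|]. apply pred_ext. intros x. split; [|easy].
        intros _ [r _]. easy.
    + intros x. rewrite universal_iff. split.
      * intros [[H _]|[n [u [r H]]]]; [now destruct (H v0)|].
        exists (Cantor.to_nat (n, u)). rewrite Cantor.cancel_of_to. now exists r.
      * intros [m [r H]]. right. eauto.
  - assert (Hm : forall v, ~ Rel v w) by eauto.
    apply Sigma_open; [easy|]. apply Hloc. intros x. rewrite universal_iff.
    intros [[_ [k [Hk1 Hk2]]]|[n [u [r _]]]]; [|now destruct (Hm u)].
    exists (fun y => P y (sg k) true /\
      forall j, j < length (string_of k) -> P y j (nth j (string_of k) false)).
    split; [|split; [easy|]].
    + apply HO'; [easy|]. apply topology_forall_lt with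
        (U := fun j y => P y j (nth j (string_of k) false)); [|easy]. now split.
    + intros y [Hy1 Hy2]. rewrite universal_iff. left. split; eauto.
Qed.

Lemma Sigma_inv {X : Type} (O : (X -> Prop) -> Prop) (Rel : nat -> nat -> Prop)
  (w : nat) (A : X -> Prop) :
  Sigma O Rel w A ->
  ((forall v, ~ Rel v w) /\ O A) \/
  exists (B : nat -> X -> Prop) (v : nat -> nat), (forall n, Rel (v n) w) /\
    (forall n, Sigma O Rel (v n) (fun x => ~ B n x)) /\
    (forall x, A x <-> exists n, B n x).
Proof. destruct 1; eauto 8. Qed.

(** [h] is a code of [A]. Allowing every reading map [sg] makes the induction work, since the part
    of [h] for [(n, u)] is read through [subindex]. *)
Lemma universal_complete (Rel : nat -> nat -> Prop) :
  well_founded Rel ->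
  forall w a A, Sigma cantor_open Rel w A ->
  exists h : Cantor, forall sg x, (forall k, x (sg k) = h k) ->
    (A x <-> universal Rel w a sg (fun n b => x n = b)).
Proof.
  intros Hwf w. induction w as [w IH] using (well_founded_induction Hwf).
  intros a A HA. apply Sigma_inv in HA.
  destruct HA as [[Hmin HA]|[B [v [Hv [HB HAB]]]]].
  (* Bit [k] tells whether the [k]-th cylinder lies inside [A]. *)
  - exists (fun k => if excluded_middle_informative (forall b, cyl (string_of k) b -> A b)
      then true else false).
    intros sg x Hx. rewrite universal_iff. split.
    + intros Ax. left. split; [easy|].
      destruct (HA x Ax) as [m Hm]. destruct (string_of_surj (prefix x m)) as [k Hk].
      exists k. rewrite Hx, Hk. split.
      * destruct (excluded_middle_informative _) as [_|H]; [easy|].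
        exfalso. apply H. intros b Hb. apply Hm. intros i Hi.
        unfold cyl in Hb. rewrite prefix_length in Hb.
        now rewrite <- (nth_prefix b m i false), Hb, nth_prefix.
      * intros j Hj. rewrite prefix_length in Hj. symmetry. now apply nth_prefix.
    + intros [[_ [k [Hk1 Hk2]]]|[n [u [r _]]]]; [|now destruct (Hmin u)].
      rewrite Hx in Hk1.
      destruct (excluded_middle_informative _) as [H|_]; [|easy].
      apply H. now apply (cyl_nth _ _ false).
  - assert (Htriv : forall u, Sigma cantor_open Rel u (fun _ => True)).
    { intros u. apply Sigma_trivial; [easy| |]; intros b; [easy|]. now exists 0. }
    (* Column [(n, u)] codes the complement of [B n] if [u = v n] and the whole space for other [u]
       below [w], so that wrong guesses of the index add nothing to the union. *)
    assert (H : forall p : nat * nat, exists h : Cantor, forall r : Rel (snd p) w,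
      forall sg x, (forall k, x (sg k) = h k) ->
      (~ (snd p = v (fst p) /\ B (fst p) x) <->
        universal Rel (snd p) (Acc_inv a r) sg (fun n b => x n = b))).
    { intros [n u]. simpl.
      destruct (classic (Rel u w)) as [r|Hr]; [|exists (fun _ => true); easy].
      assert (HS : Sigma cantor_open Rel u (fun x => ~ (u = v n /\ B n x))).
      { destruct (Nat.eq_dec u (v n)) as [->|Hne].
        - eapply eq_ind; [exact (HB n)|]. apply pred_ext. intros x. tauto.
        - eapply eq_ind; [exact (Htriv u)|]. apply pred_ext. intros x. tauto. }
      destruct (IH u r (Acc_inv a r) _ HS) as [h Hh]. exists h. intros r'.
      now rewrite (proof_irrelevance _ r' r). }
    apply functional_choice in H. destruct H as [g Hg].
    exists (fun k => let (m, i) := Cantor.of_nat k in g (Cantor.of_nat m) i).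
    intros sg x Hx.
    assert (Hsub : forall n u k, x (sg (subindex n u k)) = g (n, u) k).
    { intros n u k. rewrite Hx. unfold subindex. now rewrite !Cantor.cancel_of_to. }
    rewrite universal_iff, HAB. split.
    + intros [n Hn]. right. exists n, (v n), (Hv n).
      intros H. apply (Hg (n, v n) (Hv n) _ x (Hsub n (v n))) in H. now apply H.
    + intros [[Hmin _]|[n [u [r H]]]]; [now destruct (Hmin (v 0))|].
      exists n. apply NNPP. intros Hn. apply H.
      apply (Hg (n, u) r); [apply Hsub|]. simpl. tauto.
Qed.

(** Diagonal argument: a code [h] of the complement, read with the identity and evaluated at [h]
    itself, gives a statement equivalent to its negation. *)
Lemma universal_not_Pi (Rel : nat -> nat -> Prop) (w : nat) (a : Acc Rel w) :
  well_founded Rel ->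
  ~ Sigma cantor_open Rel w
      (fun x => ~ universal Rel w a (fun k => k) (fun n b => x n = b)).
Proof.
  intros Hwf H. destruct (universal_complete Rel Hwf w a _ H) as [h Hh].
  specialize (Hh (fun k => k) h (fun k => eq_refl)). tauto.
Qed.

(** * Embedding the Cantor space into the body *)

(** For a general pair this may hold for both values of [b] or for neither; what matters is that it
    is an open condition. *)
Definition split_bit (z : Cantor * Cantor) (n : nat) (b : bool) : Prop :=
  exists l, fst z l <> snd z l /\ frame_code l = (n, b).

Lemma prod_cantor_topology : topology (prod_open cantor_open cantor_open).
Proof.
  assert (HT : cantor_open (fun _ => True)) by (intros a _; now exists 0).
  assert (HI : forall U V, cantor_open U -> cantor_open V -> cantor_open (fun x => U x /\ V x)).
  { intros U V HU HV x [Ux Vx]. destruct (HU x Ux) as [n Hn], (HV x Vx) as [m Hm].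
    exists (max n m). intros b Hb. split; [apply Hn|apply Hm]; intros k Hk; apply Hb; lia. }
  split; [|split].
  - intros A HA z Az. destruct (HA z Az) as [W [HW [Wz WA]]].
    destruct (HW z Wz) as [U [V [HU [HV [Uz [Vz HUV]]]]]].
    exists U, V. repeat split; auto.
  - intros z _. exists (fun _ => True), (fun _ => True). auto 8.
  - intros W W' HW HW' z [Wz Wz'].
    destruct (HW z Wz) as [U [V [HU [HV [Uz [Vz HUV]]]]]].
    destruct (HW' z Wz') as [U' [V' [HU' [HV' [Uz' [Vz' HUV']]]]]].
    exists (fun x => U x /\ U' x), (fun x => V x /\ V' x).
    repeat split; auto; now (apply HUV || apply HUV').
Qed.

Lemma body_topology (T : list bool -> list bool -> Prop) : topology (body_open T).
Proof.
  destruct prod_cantor_topology as [Hloc [HT HI]]. split; [|split].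
  - intros A HA.
    exists (fun z => exists U, prod_open cantor_open cantor_open U /\ U z /\
      forall y : body_space T, U (proj1_sig y) -> A y). split.
    + apply Hloc. intros z [U [HU [Uz UA]]]. exists U. repeat split; auto.
      intros y Uy. now exists U.
    + intros z. split; [|intros [U [_ [Uz UA]]]; auto].
      intros Az. destruct (HA z Az) as [W [[U [HU HW]] [Wz WA]]].
      exists U. repeat split; [easy|now apply HW|]. intros y Uy. now apply WA, HW.
  - now exists (fun _ => True).
  - intros W W' [U [HU HW]] [U' [HU' HW']]. exists (fun z => U z /\ U' z).
    split; [now apply HI|]. intros z. now rewrite HW, HW'.
Qed.

Lemma split_bit_open (n : nat) (b : bool) :
  prod_open cantor_open cantor_open (fun z => split_bit z n b).
Proof.
  intros [x y] [l [Hl Hc]]. simpl in *.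
  exists (cyl (prefix x (S l))), (cyl (prefix y (S l))).
  repeat split; auto using cyl_open, cyl_prefix.
  intros [x' y'] Hx Hy. exists l. split; [|easy]. simpl in *.
  unfold cyl in Hx, Hy. rewrite prefix_length in Hx, Hy.
  rewrite <- (nth_prefix x' (S l) l false), <- (nth_prefix y' (S l) l false) by lia.
  rewrite Hx, Hy, !nth_prefix by lia. easy.
Qed.

(** * Fusion along two finer complete metrics *)

Local Open Scope R_scope.

Lemma small_cover {X : Type} (d : X -> X -> R) (n : nat) :
  is_metric d -> metric_separable d ->
  exists B : nat -> X -> Prop, (forall x, exists i, B i x) /\
    forall i x y, B i x -> B i y -> d x y < / INR (S n).
Proof.
  intros [_ [_ [Hsym Htri]]] [D HD].
  assert (Hpos : 0 < / INR (S n)) by (apply Rinv_0_lt_compat, lt_0_INR; lia).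
  exists (fun i x => d x (D i) < / INR (S n) / 2). split.
  - intros x. apply HD. lra.
  - intros i x y Hx Hy. specialize (Htri x (D i) y). rewrite (Hsym (D i) y) in Htri. lra.
Qed.

Lemma inv_INR_small (eps : R) : 0 < eps -> exists n, / INR (S n) < eps.
Proof.
  intros H. destruct (archimed_cor1 eps H) as [N [HN HN0]].
  exists (pred N). now replace (S (pred N)) with N by lia.
Qed.

Lemma inv_INR_le (n m : nat) : (n <= m)%nat -> / INR (S m) <= / INR (S n).
Proof.
  intros H. apply Rinv_le_contravar; [apply lt_0_INR; lia|]. apply le_INR. lia.
Qed.

(* The [B n] contain points close to [a] in the Cantor topology; these form a Cauchy
   sequence for [d], whose limit can only be [a] because [d] refines that topology. *)
Lemma fusion_limit (d : Cantor -> Cantor -> R) (u w : nat -> list bool)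
  (B : nat -> Cantor -> Prop) (a : Cantor) :
  is_metric d -> metric_complete d -> finer (metric_open d) cantor_open ->
  (forall n, u (S n) = u n ++ w n) -> (forall n, w n <> []) ->
  (forall n, cyl (u n) a) ->
  (forall n, exists y, B n y /\ cyl (u n) y) ->
  (forall n y, B (S n) y -> B n y) ->
  (forall n y y', B (S n) y -> B (S n) y' -> d y y' < / INR (S n)) ->
  forall n y, B (S n) y -> d a y <= / INR (S n).
Proof.
  intros [Hpos [Hzero [Hsym Htri]]] Hcomp Hfin Hu Hw Ha HB Hdec Hdiam.
  apply functional_choice in HB. destruct HB as [y Hy].
  assert (Hdec' : forall k n z, B (n + k)%nat z -> B n z).
  { induction k as [|k IH]; intros n z Hz; [now rewrite Nat.add_0_r in Hz|].
    rewrite Nat.add_succ_r in Hz. auto. }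
  assert (Hyn : forall n m, (n <= m)%nat -> B n (y m)).
  { intros n m H. apply Hdec' with (m - n)%nat.
    replace (n + (m - n))%nat with m by lia. apply Hy. }
  assert (Hlen : forall n, (n <= length (u n))%nat).
  { induction n as [|n IH]; [lia|]. rewrite Hu, length_app.
    specialize (Hw n). destruct (w n); [easy|]. simpl. lia. }
  destruct (Hcomp y) as [x Hx].
  { intros eps Heps. destruct (inv_INR_small eps Heps) as [N HN].
    exists (S N). intros m n Hm Hn. apply Rlt_trans with (/ INR (S N)); auto. }
  assert (Exa : x = a).
  { apply functional_extensionality. intros i.
    assert (Hop := Hfin _ (cyl_open (prefix x (S i)))).
    destruct (Hop x (cyl_prefix x (S i))) as [eps [Heps Hball]].
    destruct (Hx eps Heps) as [N HN].
    specialize (HN (max N (S i)) (Nat.le_max_l _ _)). rewrite Hsym in HN.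
    apply Hball in HN. set (m := max N (S i)) in *.
    unfold cyl in HN. rewrite prefix_length in HN.
    rewrite <- (nth_prefix x (S i) i false), <- HN, nth_prefix by lia.
    assert (Hi : (i < length (u m))%nat) by (specialize (Hlen m); lia).
    rewrite (proj1 (cyl_nth _ _ false) (proj2 (Hy m)) i Hi).
    now rewrite (proj1 (cyl_nth _ _ false) (Ha m) i Hi). }
  (* [a] need not belong to [B (S n)], so its distance to [z] is estimated through far terms of [y],
     which do; the limit leaves a non-strict bound. *)
  subst x. intros n z Hz. apply Rnot_lt_le. intros Hlt.
  destruct (Hx (d a z - / INR (S n))) as [N HN]; [lra|].
  specialize (HN (max N (S n)) (Nat.le_max_l _ _)).
  assert (H1 := Hdiam n _ z (Hyn (S n) (max N (S n)) (Nat.le_max_r _ _)) Hz).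
  specialize (Htri a (y (max N (S n))) z). rewrite (Hsym a (y _)) in Htri. lra.
Qed.

Record stage : Type := Stage {
  stage_left : list bool;
  stage_right : list bool;
  stage_left_set : Cantor -> Prop;
  stage_right_set : Cantor -> Prop }.

Definition good_stage (q : stage) : Prop :=
  frame_tree (stage_left q) (stage_right q) /\
  everywhere_nonmeager (stage_left q) (stage_left_set q) /\
  everywhere_nonmeager (stage_right q) (stage_right_set q).

(** The common block followed by different bits at a position labelled [(n, b)] records bit [n] and
    creates no other difference. *)
Definition next_stage (d d' : Cantor -> Cantor -> R) (n : nat) (b : bool) (q q' : stage) : Prop :=
  good_stage q' /\
  (exists w, stage_left q' = stage_left q ++ w ++ [false] /\
    stage_right q' = stage_right q ++ w ++ [true] /\
    frame_code (length (stage_left q ++ w)) = (n, b)) /\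
  (forall x, stage_left_set q' x -> stage_left_set q x) /\
  (forall x, stage_right_set q' x -> stage_right_set q x) /\
  (forall x y, stage_left_set q' x -> stage_left_set q' y -> d x y < / INR (S n)) /\
  (forall x y, stage_right_set q' x -> stage_right_set q' y -> d' x y < / INR (S n)).

(** [w1] leads to a small piece of the left set, then [w2] to one of the right set, both strings
    being extended alike. Zeros pad up to a position [l] whose frame is exactly this pair and whose
    label is [(n, b)]. *)
Lemma next_stage_exists (d d' : Cantor -> Cantor -> R) (n : nat) (b : bool) (q : stage) :
  is_metric d -> metric_separable d -> is_metric d' -> metric_separable d' ->
  good_stage q -> exists q', next_stage d d' n b q q'.
Proof.
  intros Hd Hds Hd' Hds' [HT [HL HR]].
  destruct q as [s t A A']. simpl in *.
  destruct (small_cover d n Hd Hds) as [C [HC HCd]].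
  destruct (small_cover d' n Hd' Hds') as [C' [HC' HCd']].
  destruct (everywhere_nonmeager_split _ _ _ HL HC) as [w1 [i Hi]].
  apply everywhere_nonmeager_app with (w := w1) in HR.
  destruct (everywhere_nonmeager_split _ _ _ HR HC') as [w2 [j Hj]].
  destruct (frame_data_cofinal (s ++ w1 ++ w2) (t ++ w1 ++ w2) n b (length (s ++ w1 ++ w2)))
    as [l [Hl Hfl]].
  set (w := w1 ++ w2 ++ repeat false (l - length (s ++ w1 ++ w2))).
  assert (Hst := frame_tree_length _ _ HT).
  assert (Es : s ++ w = frame_left l).
  { unfold frame_left, w. rewrite Hfl. cbv zeta. simpl fst. now rewrite !app_assoc. }
  assert (Et : t ++ w = frame_right l).
  { unfold frame_right, w. rewrite Hfl. cbv zeta. simpl fst. simpl snd.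
    replace (length (s ++ w1 ++ w2)) with (length (t ++ w1 ++ w2))
      by (rewrite !length_app; lia).
    now rewrite !app_assoc. }
  assert (El : length (s ++ w) = l).
  { unfold w. rewrite !length_app, repeat_length. rewrite !length_app in *. lia. }
  exists (Stage (s ++ w ++ [false]) (t ++ w ++ [true])
    (fun x => A x /\ C i x) (fun x => A' x /\ C' j x)).
  split; [|split; [|split; [|split; [|split]]]]; simpl.
  - split; [|split]; simpl.
    + rewrite !app_assoc. apply frame_tree_split; rewrite ?El; auto using frame_tree_app.
    + replace (s ++ w ++ [false]) with ((s ++ w1) ++
        (w2 ++ repeat false (l - length (s ++ w1 ++ w2))) ++ [false])
        by (unfold w; now rewrite !app_assoc).
      now apply everywhere_nonmeager_app.
    + replace (t ++ w ++ [true]) with (((t ++ w1) ++ w2) ++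
        repeat false (l - length (s ++ w1 ++ w2)) ++ [true])
        by (unfold w; now rewrite !app_assoc).
      now apply everywhere_nonmeager_app.
  - exists w. repeat split. rewrite El. unfold frame_code. now rewrite Hfl.
  - tauto.
  - tauto.
  - intros x y [_ Hx] [_ Hy]. eauto.
  - intros x y [_ Hx] [_ Hy]. eauto.
Qed.

Lemma body_embedding (d d' : Cantor -> Cantor -> R) :
  is_metric d -> metric_complete d -> metric_separable d ->
  finer (metric_open d) cantor_open ->
  is_metric d' -> metric_complete d' -> metric_separable d' ->
  finer (metric_open d') cantor_open ->
  exists f : Cantor -> Cantor * Cantor,
    (forall W, prod_open (metric_open d) (metric_open d') W ->
      cantor_open (fun x => W (f x))) /\
    (forall x, body frame_tree (f x)) /\
    (forall x n b, split_bit (f x) n b <-> x n = b).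
Proof.
  intros Hd Hdc Hds Hdf Hd' Hdc' Hds' Hdf'.
  (* The guard [good_stage] makes [next] total, so the stages are defined by recursion first and
     shown good afterwards. *)
  assert (H : forall p : nat * bool * stage, exists q', good_stage (snd p) ->
    next_stage d d' (fst (fst p)) (snd (fst p)) (snd p) q').
  { intros [[n b] q]. simpl. destruct (classic (good_stage q)) as [Hq|Hq].
    - destruct (next_stage_exists d d' n b q Hd Hds Hd' Hds' Hq) as [q' Hq']. now exists q'.
    - now exists q. }
  apply functional_choice in H. destruct H as [next Hnext].
  pose (st := fun x : Cantor => fix st n := match n with
    | O => Stage [] [] (fun _ => True) (fun _ => True)
    | S n => next (n, x n, st n) end).
  assert (Hgood : forall x n, good_stage (st x n)).
  { intros x. induction n as [|n IH].
    - split; [constructor|]. split; apply everywhere_nonmeager_full.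
    - exact (proj1 (Hnext (n, x n, st x n) IH)). }
  assert (Hst : forall x n, next_stage d d' n (x n) (st x n) (st x (S n))).
  { intros x n. exact (Hnext (n, x n, st x n) (Hgood x n)). }
  (* Stage [n] reads only the first [n] bits of [x]; this is the source of continuity. *)
  assert (Hloc : forall x x' n, (forall k, (k < n)%nat -> x' k = x k) -> st x' n = st x n).
  { intros x x'. induction n as [|n IH]; intros Hk; [easy|].
    simpl. rewrite (Hk n) by lia. rewrite IH; auto. }
  assert (Hw : forall x, exists w : nat -> list bool, forall n,
    stage_left (st x (S n)) = stage_left (st x n) ++ w n ++ [false] /\
    stage_right (st x (S n)) = stage_right (st x n) ++ w n ++ [true] /\
    frame_code (length (stage_left (st x n) ++ w n)) = (n, x n)).
  { intros x.
    apply (functional_choice (fun n w =>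
      stage_left (st x (S n)) = stage_left (st x n) ++ w ++ [false] /\
      stage_right (st x (S n)) = stage_right (st x n) ++ w ++ [true] /\
      frame_code (length (stage_left (st x n) ++ w)) = (n, x n))).
    intros n. apply (Hst x n). }
  assert (Hf : forall x, exists z : Cantor * Cantor,
    (forall n, cyl (stage_left (st x n)) (fst z)) /\
    (forall n, cyl (stage_right (st x n)) (snd z))).
  { intros x. destruct (Hw x) as [w Hwx].
    destruct (cyl_limit (fun n => stage_left (st x n)) (fun n => w n ++ [false])) as [a Ha].
    { intros n. apply Hwx. }
    { intros n E. now apply app_eq_nil in E. }
    destruct (cyl_limit (fun n => stage_right (st x n)) (fun n => w n ++ [true])) as [a' Ha'].
    { intros n. apply Hwx. }
    { intros n E. now apply app_eq_nil in E. }
    now exists (a, a'). }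
  apply functional_choice in Hf. destruct Hf as [f Hf].
  assert (Hlim : forall x n y, stage_left_set (st x (S n)) y -> d (fst (f x)) y <= / INR (S n)).
  { intros x. destruct (Hw x) as [w Hwx].
    apply fusion_limit with (u := fun n => stage_left (st x n)) (w := fun n => w n ++ [false])
      (B := fun n => stage_left_set (st x n)); auto.
    - intros n. apply Hwx.
    - intros n E. now apply app_eq_nil in E.
    - intros n. apply Hf.
    - intros n. apply everywhere_nonmeager_inhabited, Hgood.
    - intros n. apply (Hst x n).
    - intros n. apply (Hst x n). }
  assert (Hlim' : forall x n y, stage_right_set (st x (S n)) y -> d' (snd (f x)) y <= / INR (S n)).
  { intros x. destruct (Hw x) as [w Hwx].
    apply fusion_limit with (u := fun n => stage_right (st x n)) (w := fun n => w n ++ [true])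
      (B := fun n => stage_right_set (st x n)); auto.
    - intros n. apply Hwx.
    - intros n E. now apply app_eq_nil in E.
    - intros n. apply Hf.
    - intros n. apply everywhere_nonmeager_inhabited, Hgood.
    - intros n. apply (Hst x n).
    - intros n. apply (Hst x n). }
  assert (Hlen : forall x n, (n <= length (stage_left (st x n)))%nat).
  { intros x. destruct (Hw x) as [w Hwx]. induction n as [|n IH]; [lia|].
    rewrite (proj1 (Hwx n)), !length_app. simpl. lia. }
  assert (Hlr : forall x n, length (stage_left (st x n)) = length (stage_right (st x n))).
  { intros x n. apply frame_tree_length, Hgood. }
  exists f. split; [|split].
  - intros W HW x Wx. destruct (HW _ Wx) as [U [V [HU [HV [Ux [Vx HUV]]]]]].
    destruct (HU _ Ux) as [e [He HeU]]. destruct (HV _ Vx) as [e' [He' HeV]].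
    destruct (inv_INR_small (e / 2)) as [N HN]; [lra|].
    destruct (inv_INR_small (e' / 2)) as [N' HN']; [lra|].
    set (M := max N N').
    assert (HM := inv_INR_le N M (Nat.le_max_l _ _)).
    assert (HM' := inv_INR_le N' M (Nat.le_max_r _ _)).
    (* Points agreeing on the first [S M] bits share stage [S M]. On each side, any point of its set
       is within [/ INR (S M)] of the coordinates of both images. *)
    exists (S M). intros x' Hx'. assert (E := Hloc x x' (S M) Hx').
    apply HUV.
    + apply HeU.
      destruct (everywhere_nonmeager_inhabited _ _ (proj1 (proj2 (Hgood x (S M))))) as [y [Hy _]].
      assert (H1 := Hlim x M y Hy). rewrite <- E in Hy. assert (H2 := Hlim x' M y Hy).
      destruct Hd as [_ [_ [Hsym Htri]]].
      specialize (Htri (fst (f x)) y (fst (f x'))). rewrite (Hsym y) in Htri. lra.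
    + apply HeV.
      destruct (everywhere_nonmeager_inhabited _ _ (proj2 (proj2 (Hgood x (S M))))) as [y [Hy _]].
      assert (H1 := Hlim' x M y Hy). rewrite <- E in Hy. assert (H2 := Hlim' x' M y Hy).
      destruct Hd' as [_ [_ [Hsym Htri]]].
      specialize (Htri (snd (f x)) y (snd (f x'))). rewrite (Hsym y) in Htri. lra.
  - intros x p.
    destruct (Hf x) as [HL HR]. specialize (HL p). specialize (HR p).
    (* The stage strings have length at least [p], so the prefixes are restrictions of a pair in the
       tree. *)
    rewrite <- (firstn_prefix _ p (length (stage_left (st x p)))) by apply Hlen.
    rewrite <- (firstn_prefix (snd (f x)) p (length (stage_right (st x p))))
      by (rewrite <- Hlr; apply Hlen).
    rewrite HL, HR. apply frame_tree_is_tree; [apply Hgood|apply Hlen].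
  - intros x n b. destruct (Hw x) as [w Hwx]. destruct (Hf x) as [HL HR].
    (* The coordinates differ only at the last position of each stage, whose label is correct for
       [x]; hence no false bit is recorded. *)
    assert (Hdiff : forall m l, (l < length (stage_left (st x m)))%nat ->
      fst (f x) l <> snd (f x) l -> frame_code l = (fst (frame_code l), x (fst (frame_code l)))).
    { induction m as [|m IH]; intros l Hl Hne; [simpl in Hl; lia|].
      destruct (Hwx m) as [El [Er Ec]].
      destruct (Nat.lt_trichotomy l (length (stage_left (st x m) ++ w m))) as [Hlt|[->|Hgt]].
      - destruct (Nat.lt_ge_cases l (length (stage_left (st x m)))) as [H1|H1]; [auto|].
        exfalso. apply Hne.
        rewrite (proj1 (cyl_nth _ _ false) (HL (S m)) l Hl).
        rewrite Hlr in Hl.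
        rewrite (proj1 (cyl_nth _ _ false) (HR (S m)) l Hl), El, Er.
        specialize (Hlr x m). rewrite length_app in Hlt.
        rewrite app_nth2, app_nth1 by lia.
        rewrite app_nth2, app_nth1 by lia. now rewrite Hlr.
      - now rewrite Ec.
      - exfalso. rewrite El, app_assoc, length_app in Hl. simpl in Hl. lia. }
    split.
    (* Stage [S l] is long enough to contain position [l]. *)
    + intros [l [Hne Hc]]. specialize (Hdiff (S l) l (Hlen x (S l)) Hne).
      rewrite Hc in Hdiff. simpl in Hdiff. congruence.
    + intros <-. exists (length (stage_left (st x n) ++ w n)).
      destruct (Hwx n) as [El [Er Ec]]. split; [|easy].
      assert (E : length (stage_left (st x n) ++ w n) = length (stage_right (st x n) ++ w n)).
      { rewrite !length_app. now rewrite Hlr. }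
      specialize (HL (S n)). specialize (HR (S n)).
      rewrite El, app_assoc in HL. rewrite Er, app_assoc in HR.
      rewrite (proj1 (cyl_nth _ _ false) HL) by (rewrite (length_app _ [false]); simpl; lia).
      rewrite nth_middle, E.
      rewrite (proj1 (cyl_nth _ _ false) HR) by (rewrite (length_app _ [true]); simpl; lia).
      now rewrite nth_middle.
Qed.

(** * The set coded by the splitting labels, and its pullback to the diagonal *)

Theorem theorem1p11 :
  exists T : list bool -> list bool -> Prop,
    is_tree T /\ acyclic_levels T /\
    forall (Rel : nat -> nat -> Prop), countable_wellorder Rel ->
    forall w : nat,
      exists S : Cantor * Cantor -> Prop,
        (forall z, S z -> body T z) /\
        Sigma (body_open T) Rel w (fun z : body_space T => S (proj1_sig z)) /\
        ~ pot_Pi Rel w S.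
Proof.
  exists frame_tree. split; [exact frame_tree_is_tree|].
  split; [exact frame_tree_acyclic|].
  intros Rel [Hwf _] w.
  (* The body is imposed explicitly, as [split_bit] speaks about arbitrary pairs. *)
  exists (fun z => body frame_tree z /\
    universal Rel w (Hwf w) (fun k => k) (split_bit z)).
  split; [tauto|split].
  - eapply eq_ind.
    + apply (universal_Sigma (body_open frame_tree) Rel
        (fun z => split_bit (proj1_sig z)) (body_topology _) Hwf) with (w := w).
      intros n b. exists (fun z => split_bit z n b). split; [apply split_bit_open|easy].
    + apply pred_ext. intros [z Hz]. simpl. split; [|intros [_ H]; exact H]. tauto.
  - intros [Os [Ot [[d [Hd [Hdc [Hds HO]]]] [HOf [[d' [Hd' [Hdc' [Hds' HO']]]] [HOf' HP]]]]]].
    (* Each topology is identified with the open sets of its metric, so that the embedding for the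
       two metrics applies. *)
    apply pred_ext in HO, HO'. subst Os Ot.
    destruct (body_embedding d d') as [f [Hcont [Hbody Hbit]]]; auto.
    apply (universal_not_Pi Rel w (Hwf w) Hwf).
    (* Since [f x] lies in the body and codes exactly [x], the complement of the set pulls back to
       the complement of the diagonal, which would thus be in the additive class. *)
    apply (Sigma_preimage cantor_open _ Rel f) in HP; [|exact Hcont].
    eapply eq_ind; [exact HP|]. apply pred_ext. intros x. simpl.
    replace (fun n b => x n = b) with (split_bit (f x)).
    + specialize (Hbody x). tauto.
    + apply functional_extensionality. intros n. apply pred_ext. intros b. apply Hbit.
Qed.
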